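(* Let $(M,\phi,\xi,\eta,g)$ be a $3$-dimensional trans-Sasakian manifold of type $(\alpha,\beta)$ with $\alpha\neq 0$ and $\beta\neq 0$ (everywhere), and let $\gamma: I\to M$ be a Frenet curve (parametrized by arc length) with torsion $\tau$. Set $\sigma=\eta(\gamma'):I\to\mathbb{R}$, suppose that $\gamma'$ is nowhere collinear with $\xi$ (i.e. $\sigma^2<1$ on $I$), and let $p,q:I\to\mathbb{R}$ be the functions determined by $$\nabla_{\gamma'}\gamma'=\frac{p}{\sqrt{1-\sigma^2}}\,\phi\gamma'+\frac{q}{\sqrt{1-\sigma^2}}\,(\xi-\sigma\gamma').$$ Suppose that $p$ is a non-zero constant on $I$, and put $$l_1=\frac{1}{\sqrt{1-\sigma^2}},\qquad l_2=-\frac{pq\sigma}{\sqrt{1-\sigma^2}\,(p^2+q^2)},\qquad l_3=-\frac{p^2}{p^2+q^2}\,\gamma'\!\left(\frac{\beta}{p}\right),$$ where $\gamma'(\beta/p)$ denotes the derivative $\frac{d}{ds}\big(\beta(\gamma(s))/p\big)$. If $$\tau=|l_1\alpha+l_2\beta+l_3|\quad\text{on } I$$ (with $\alpha,\beta$ evaluated along $\gamma$) and at one point of $I$ one has $\sigma=\sigma'=\sigma''=0$, then $\gamma$ is an almost contact curve, i.e. $\eta(\gamma')=0$ on all of $I$.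
   Context: An almost contact metric structure on a $(2n+1)$-dimensional manifold $M$ is a quadruple $(\phi,\xi,\eta,g)$ of a $(1,1)$-tensor field $\phi$, a vector field $\xi$, a $1$-form $\eta$ and a Riemannian metric $g$ with $\phi^2=-I+\eta\otimes\xi$, $\eta(\xi)=1$ (hence $\phi\xi=0$, $\eta\circ\phi=0$), $g(\phi X,\phi Y)=g(X,Y)-\eta(X)\eta(Y)$ and $g(X,\xi)=\eta(X)$ for all vector fields $X,Y$. Let $\nabla$ be the Levi-Civita connection of $g$. A trans-Sasakian manifold of type $(\alpha,\beta)$ is a connected manifold $M$ with an almost contact metric structure such that $$(\nabla_X\phi)Y=\alpha\big(g(X,Y)\xi-\eta(Y)X\big)+\beta\big(g(\phi X,Y)\xi-\eta(Y)\phi X\big)$$ for all vector fields $X,Y$, where $\alpha,\beta$ are smooth functions on $M$; it then follows that $(\nabla_X\eta)(Y)=-\alpha g(\phi X,Y)+\beta g(\phi X,\phi Y)$. A unit speed curve $\gamma:I\to M$ in a Riemannian manifold is an $r$-Frenet curve if there are an orthonormal frame field $(E_1=\gamma',E_2,\dots,E_r)$ along $\gamma$ and positive smooth functions $k_1,\dots,k_{r-1}$ with $\nabla_{\gamma'}E_1=k_1E_2$, $\nabla_{\gamma'}E_2=-k_1E_1+k_2E_3$, ..., $\nabla_{\gamma'}E_r=-k_{r-1}E_{r-1}$. In dimension $3$ one writes $(E_1,E_2,E_3)=(T,N,B)$, $k_1=\kappa$ (curvature), $k_2=\tau$ (torsion), so that $\nabla_TT=\kappa N$, $\nabla_TN=-\kappa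 T+\tau B$, $\nabla_TB=-\tau N$; for $r=2$ one has $\tau=0$. Thus $\kappa=|\nabla_TT|$ and $\tau=|\nabla_TN+\kappa T|$. A Frenet curve $\gamma$ in an almost contact metric $3$-manifold is an almost contact curve if it is an integral curve of the distribution $D=\ker\eta$, i.e. $\eta(\gamma')=0$ along $\gamma$. Primes on functions on $I$ denote derivatives with respect to arc length $s$. *)

(* Defs.v *)
From HB Require Import structures.
From mathcomp Require Import all_boot all_order all_algebra.
From mathcomp Require Import all_classical all_reals all_analysis.
From mathcomp Require Import ring.

Set Implicit Arguments.
Unset Strict Implicit.
Unset Printing Implicit Defensive.

Import Order.TTheory GRing.Theory Num.Theory.
Import numFieldNormedType.Exports.

Local Open Scope classical_set_scope.
Local Open Scope ring_scope.

(** Maps of class C^k and C^oo on an open subset [U] of a finite-dimensional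
    space: [f] is differentiable at the points of [U] and all its directional
    derivatives are of class C^(k-1).  Values of [f] outside [U] play no role
    when [U] is open. *)
Fixpoint Ck (R : realType) (V W : normedModType R) (k : nat) (U : set V)
    (f : V -> W) : Prop :=
  if k is k'.+1 then
    (forall x, U x -> differentiable f x) /\ (forall v, Ck k' U ('D_v f))
  else forall x, U x -> {for x, continuous f}.

Definition smooth_on (R : realType) (V W : normedModType R) (U : set V)
    (f : V -> W) : Prop :=
  forall k, Ck k U f.

(** [chart_inv c] is the inverse of the homeomorphism [chart_map c] from
    [chart_dom c] onto the open set [chart_codom c]. *)
Record chart (R : realType) (d : nat) (T : topologicalType) := Chart {
  chart_dom : set T;
  chart_map : T -> 'rV[R]_d;
  chart_inv : 'rV[R]_d -> T;
  open_chart_dom : open chart_dom;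
  open_chart_codom : open (chart_map @` chart_dom);
  chart_mapK : forall x, chart_dom x -> chart_inv (chart_map x) = x;
  chart_map_continuous : forall x, chart_dom x -> {for x, continuous chart_map};
  chart_inv_continuous : forall u, (chart_map @` chart_dom) u ->
    {for u, continuous chart_inv}
}.

Definition chart_codom (R : realType) (d : nat) (T : topologicalType)
    (c : chart R d T) : set 'rV[R]_d := chart_map c @` chart_dom c.

(** [chart_at x] is a preferred chart around [x]. It serves to
    represent the tangent space at [x] by ['rV[R]_d], namely by the components
    of tangent vectors in the chart [chart_at x]. *)
Record smooth_manifold (R : realType) (d : nat) := SmoothManifold {
  points :> topologicalType;
  manifold_hausdorff : hausdorff_space points;
  manifold_second_countable : @second_countable points;
  atlas : set (chart R d points);
  chart_at : points -> chart R d points;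
  chart_at_atlas : forall x, atlas (chart_at x);
  mem_chart_at : forall x, chart_dom (chart_at x) x;
  transition_smooth : forall c c', atlas c -> atlas c' ->
    smooth_on (chart_map c @` (chart_dom c `&` chart_dom c'))
      (chart_map c' \o chart_inv c)
}.

Section Tensors.
Variables (R : realType) (d : nat) (M : smooth_manifold R d).

Local Notation chart := (chart R d M).

(** Change of components of tangent vectors at [x] from the chart [c] to the
    chart [c'] (vectors are rows, so matrices act on the right). *)
Definition tangent_change (c c' : chart) (x : M) : 'M[R]_d :=
  'J (chart_map c' \o chart_inv c) (chart_map c x).

(** A vector field, a 1-form, a (1,1)-tensor field and a field of bilinear
    forms are given at [x] by a row, a column, a matrix [A] acting by
    [v |-> v *m A] and a Gram matrix in the chart [chart_at x]. *)
Definition form_app (eta : M -> 'cV[R]_d) (x : M) (v : 'rV[R]_d) : R :=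
  (v *m eta x) 0 0.

Definition metric_app (g : M -> 'M[R]_d) (x : M) (v w : 'rV[R]_d) : R :=
  (v *m g x *m w^T) 0 0.

(** Components of these fields in an arbitrary chart [c], as functions of the
    coordinates. *)
Definition vector_in (X : M -> 'rV[R]_d) (c : chart) (u : 'rV[R]_d) :=
  let x := chart_inv c u in X x *m tangent_change (chart_at x) c x.

Definition form_in (eta : M -> 'cV[R]_d) (c : chart) (u : 'rV[R]_d) :=
  let x := chart_inv c u in tangent_change c (chart_at x) x *m eta x.

Definition endo_in (phi : M -> 'M[R]_d) (c : chart) (u : 'rV[R]_d) :=
  let x := chart_inv c u in
  tangent_change c (chart_at x) x *m phi x *m tangent_change (chart_at x) c x.

Definition metric_in (g : M -> 'M[R]_d) (c : chart) (u : 'rV[R]_d) :=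
  let x := chart_inv c u in
  tangent_change c (chart_at x) x *m g x
    *m (tangent_change c (chart_at x) x)^T.

Definition smooth_function (f : M -> R) :=
  forall c, atlas c -> smooth_on (chart_codom c) (f \o chart_inv c).

Definition smooth_vector (X : M -> 'rV[R]_d) :=
  forall c, atlas c -> smooth_on (chart_codom c) (vector_in X c).

Definition smooth_form (eta : M -> 'cV[R]_d) :=
  forall c, atlas c -> smooth_on (chart_codom c) (form_in eta c).

Definition smooth_endo (phi : M -> 'M[R]_d) :=
  forall c, atlas c -> smooth_on (chart_codom c) (endo_in phi c).

Definition smooth_metric (g : M -> 'M[R]_d) :=
  forall c, atlas c -> smooth_on (chart_codom c) (metric_in g c).

Definition riemannian_metric (g : M -> 'M[R]_d) : Prop :=
  [/\ smooth_metric g,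
      forall x v w, metric_app g x v w = metric_app g x w v
    & forall x v, v != 0 -> 0 < metric_app g x v v].

(** Levi-Civita connection: Christoffel symbols
    Gamma_ab^k = 1/2 sum_l g^(lk) (d_a g_bl + d_b g_al - d_l g_ab)
    of [g] in the chart [c]. *)
Definition dmetric (g : M -> 'M[R]_d) (c : chart) (u : 'rV[R]_d) (a : 'I_d) :
    'M[R]_d :=
  'D_(delta_mx 0 a) (metric_in g c) u.

Definition christoffel (g : M -> 'M[R]_d) (c : chart) (u : 'rV[R]_d)
    (a b k : 'I_d) : R :=
  2^-1 * \sum_(l < d)
    (dmetric g c u a b l + dmetric g c u b a l - dmetric g c u l a b)
      * invmx (metric_in g c u) l k.

(** The matrix of [w |-> (sum_(a,b) v^a w^b Gamma_ab^k)_k]. *)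
Definition connection_mx (g : M -> 'M[R]_d) (c : chart) (u v : 'rV[R]_d) :
    'M[R]_d :=
  \matrix_(b, k) \sum_(a < d) v 0 a * christoffel g c u a b k.

(** (nabla_v Y)(x) for a vector field [Y]. *)
Definition nabla_vector (g : M -> 'M[R]_d) (Y : M -> 'rV[R]_d) (x : M)
    (v : 'rV[R]_d) : 'rV[R]_d :=
  let c := chart_at x in let u := chart_map c x in
  'D_v (vector_in Y c) u + Y x *m connection_mx g c u v.

(** (nabla_v phi)(x) for a (1,1)-tensor field [phi]: the endomorphism
    [w |-> (nabla_v phi) w], see [nabla_endoE]. *)
Definition nabla_endo (g : M -> 'M[R]_d) (phi : M -> 'M[R]_d) (x : M)
    (v : 'rV[R]_d) : 'M[R]_d :=
  let c := chart_at x in let u := chart_map c x in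
  'D_v (endo_in phi c) u + phi x *m connection_mx g c u v
    - connection_mx g c u v *m phi x.

Definition smooth_curve (I : set R) (gamma : R -> M) : Prop :=
  (forall s, I s -> {for s, continuous gamma}) /\
  (forall c, atlas c ->
     smooth_on (I `&` gamma @^-1` chart_dom c) (chart_map c \o gamma)).

Definition velocity (gamma : R -> M) (s : R) : 'rV[R]_d :=
  derive1 (chart_map (chart_at (gamma s)) \o gamma) s.

(** A vector field along [gamma] maps [s] to an element of the tangent space
    at [gamma s]. *)
Definition along_in (gamma : R -> M) (V : R -> 'rV[R]_d) (c : chart) (s : R) :=
  V s *m tangent_change (chart_at (gamma s)) c (gamma s).

Definition smooth_along (I : set R) (gamma : R -> M) (V : R -> 'rV[R]_d) :=
  forall c, atlas c ->
    smooth_on (I `&` gamma @^-1` chart_dom c) (along_in gamma V c).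

(** Covariant derivative nabla_(gamma') V along [gamma]. *)
Definition nabla_along (g : M -> 'M[R]_d) (gamma : R -> M)
    (V : R -> 'rV[R]_d) (s : R) : 'rV[R]_d :=
  let c := chart_at (gamma s) in let u := chart_map c (gamma s) in
  derive1 (along_in gamma V c) s
    + V s *m connection_mx g c u (velocity gamma s).

(** [r]-Frenet curves; the frame and the curvatures are numbered from 0:
    [E i] is E_(i+1) and [k i] is k_(i+1). *)
Record frenet_curve (g : M -> 'M[R]_d) (I : set R) (gamma : R -> M)
    (r : nat) (E : nat -> R -> 'rV[R]_d) (k : nat -> R -> R) : Prop := {
  frenet_order : (0 < r)%N;
  frenet_smooth_curve : smooth_curve I gamma;
  frenet_velocity : forall s, I s -> E 0%N s = velocity gamma s;
  frenet_smooth_frame : forall i, (i < r)%N -> smooth_along I gamma (E i);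
  frenet_orthonormal : forall i j s, (i < r)%N -> (j < r)%N -> I s ->
    metric_app g (gamma s) (E i s) (E j s) = (i == j)%:R;
  frenet_curvature_smooth : forall i, (i.+1 < r)%N -> smooth_on I (k i);
  frenet_curvature_pos : forall i s, (i.+1 < r)%N -> I s -> 0 < k i s;
  frenet_equations : forall i s, (i < r)%N -> I s ->
    nabla_along g gamma (E i) s =
      (if i is i'.+1 then - k i' s *: E i' s else 0)
      + (if (i.+1 < r)%N then k i s *: E i.+1 s else 0)
}.

(** The torsion is k_2, read as 0 when the frame has fewer than 3 vectors. *)
Definition torsion (r : nat) (k : nat -> R -> R) (s : R) : R :=
  if (2 < r)%N then k 1%N s else 0.

Record almost_contact_metric (phi : M -> 'M[R]_d) (xi : M -> 'rV[R]_d)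
    (eta : M -> 'cV[R]_d) (g : M -> 'M[R]_d) : Prop := {
  acm_smooth_phi : smooth_endo phi;
  acm_smooth_xi : smooth_vector xi;
  acm_smooth_eta : smooth_form eta;
  acm_metric : riemannian_metric g;
  acm_phi2 : forall x v,
    v *m phi x *m phi x = - v + form_app eta x v *: xi x;
  acm_eta_xi : forall x, form_app eta x (xi x) = 1;
  acm_compat : forall x v w,
    metric_app g x (v *m phi x) (w *m phi x) =
      metric_app g x v w - form_app eta x v * form_app eta x w;
  acm_g_xi : forall x v, metric_app g x v (xi x) = form_app eta x v
}.

Record trans_sasakian (phi : M -> 'M[R]_d) (xi : M -> 'rV[R]_d)
    (eta : M -> 'cV[R]_d) (g : M -> 'M[R]_d) (alpha beta : M -> R) : Prop := {
  ts_connected : connected [set: M];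
  ts_acm : almost_contact_metric phi xi eta g;
  ts_smooth_alpha : smooth_function alpha;
  ts_smooth_beta : smooth_function beta;
  ts_nabla_phi : forall x v w,
    w *m nabla_endo g phi x v =
      alpha x *: (metric_app g x v w *: xi x - form_app eta x w *: v)
      + beta x *: (metric_app g x (v *m phi x) w *: xi x
                   - form_app eta x w *: (v *m phi x))
}.

Definition almost_contact_curve (eta : M -> 'cV[R]_d) (I : set R)
    (gamma : R -> M) : Prop :=
  forall s, I s -> form_app eta (gamma s) (velocity gamma s) = 0.

End Tensors.

Lemma is_derive_mulmx (R : realType) (V : normedModType R) (m n l : nat)
    (A : V -> 'M[R]_(m, n)) (B : V -> 'M[R]_(n, l)) (u v : V) :
  derivable A u v -> derivable B u v ->
  is_derive u v (fun w => A w *m B w) ('D_v A u *m B u + A u *m 'D_v B u).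
Proof.
move=> dA dB.
have dAe := (derivable_mxP _ _ _).1 dA; have dBe := (derivable_mxP _ _ _).1 dB.
have dAB i j : is_derive u v (fun w => (A w *m B w) i j)
    (('D_v A u *m B u + A u *m 'D_v B u) i j).
  rewrite (_ : (fun _ => _) = \sum_(k < n) (fun w => A w i k) *
      (fun w => B w k j)); last first.
    by apply/funext => w; rewrite !mxE fct_sumE.
  have dk k : derivable ((fun w => A w i k) * (fun w => B w k j)) u v.
    by apply: derivableM.
  apply: DeriveDef; first exact: derivable_sum.
  rewrite derive_sum// !mxE -big_split/=; apply: eq_bigr => k _.
  rewrite deriveM// (derive_mx dA) (derive_mx dB) !mxE addrC.
  by congr (_ + _); rewrite /GRing.scale/= mulrC.
have dd : derivable (fun w => A w *m B w) u v.
  by apply/derivable_mxP => i j; have [] := dAB i j.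
apply: DeriveDef => //; rewrite derive_mx//; apply/matrixP => i j.
by rewrite mxE; have [] := dAB i j.
Qed.

Section Facts.
Variables (R : realType) (d : nat) (M : smooth_manifold R d).

Lemma chart_inv_map_near (c : chart R d M) (x : M) : chart_dom c x ->
  \forall u \near chart_map c x, chart_map c (chart_inv c u) = u.
Proof.
move=> cx.
have : nbhs (chart_map c x) (chart_map c @` chart_dom c).
  by apply: open_nbhs_nbhs; split; [exact: open_chart_codom|exists x].
by apply: filterS => _ [y cy <-]; rewrite chart_mapK.
Qed.

Lemma chart_inv_dom_near (c c' : chart R d M) (x : M) :
  chart_dom c x -> chart_dom c' x ->
  \forall u \near chart_map c x, chart_dom c' (chart_inv c u).
Proof.
move=> cx c'x; apply: (@chart_inv_continuous _ _ _ c (chart_map c x)).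
  by exists x.
by rewrite chart_mapK//; apply: open_nbhs_nbhs; split => //;
  exact: open_chart_dom.
Qed.

Lemma transition_differentiable (c c' : chart R d M) (x : M) :
  atlas c -> atlas c' -> chart_dom c x -> chart_dom c' x ->
  differentiable (chart_map c' \o chart_inv c) (chart_map c x).
Proof.
move=> ac ac' cx c'x; have [+ _] := transition_smooth ac ac' 1%N.
by apply; exists x.
Qed.

Lemma tangent_changeK (c c' : chart R d M) (x : M) :
  atlas c -> atlas c' -> chart_dom c x -> chart_dom c' x ->
  tangent_change c c' x *m tangent_change c' c x = 1%:M.
Proof.
move=> ac ac' cx c'x.
have df := transition_differentiable ac ac' cx c'x.
have dh := transition_differentiable ac' ac c'x cx.
have fx : (chart_map c' \o chart_inv c) (chart_map c x) = chart_map c' x.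
  by rewrite /= chart_mapK.
apply/row_matrixP => i; rewrite -[LHS]mul1mx !rowE mul1mx mulmx1 mulmxA.
set v := delta_mx 0 i.
rewrite /tangent_change -deriveEjacobian// deriveE//.
rewrite -deriveEjacobian// deriveE// -[X in 'd _ X _]fx.
rewrite -[LHS]/(('d (chart_map c \o chart_inv c') _ \o
  'd (chart_map c' \o chart_inv c) (chart_map c x)) v).
rewrite -diff_comp ?fx// -deriveE; last first.
  by apply: differentiable_comp; rewrite ?fx.
rewrite (@near_eq_derive _ _ _ _ id) ?derive_id//.
have := chart_inv_dom_near cx c'x.
have := chart_inv_map_near cx.
by apply: filterS2 => u /= uE c'u; rewrite chart_mapK.
Qed.

Lemma tangent_change_id (c : chart R d M) (x : M) :
  atlas c -> chart_dom c x -> tangent_change c c x = 1%:M.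
Proof.
move=> ac cx; apply/row_matrixP => i; rewrite !rowE mulmx1 /tangent_change.
have nid : {near chart_map c x, id =1 chart_map c \o chart_inv c}.
  by have := chart_inv_map_near cx; apply: filterS => u /= ->.
have dj := transition_differentiable ac ac cx cx.
by rewrite -deriveEjacobian// -(near_eq_derive _ nid) derive_id.
Qed.

Section At.
Variables (g phi : M -> 'M[R]_d) (x : M).
Hypothesis hg : riemannian_metric g.
Let c := chart_at x.
Let u := chart_map c x.

Lemma metric_in_sym (c0 : chart R d M) (w : 'rV[R]_d) :
  (metric_in g c0 w)^T = metric_in g c0 w.
Proof.
have [_ gsym _] := hg; rewrite /metric_in !trmx_mul trmxK mulmxA.
congr (_ *m _ *m _); apply/matrixP => i j; rewrite mxE.
have := gsym (chart_inv c0 w) (delta_mx 0 j) (delta_mx 0 i).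
by rewrite /metric_app !trmx_delta -!rowE -!colE !mxE.
Qed.

Lemma metric_inE : metric_in g c u = g x.
Proof.
rewrite /metric_in /u chart_mapK; last exact: mem_chart_at.
rewrite tangent_change_id ?mul1mx ?trmx1 ?mulmx1//.
- exact: chart_at_atlas.
- exact: mem_chart_at.
Qed.

Lemma metric_unit : g x \in unitmx.
Proof.
have [_ _ gpos] := hg; rewrite -row_free_unit -kermx_eq0.
apply/eqP/row_matrixP => i; rewrite row0; apply/eqP/negPn/negP => n0.
have := gpos x _ n0; rewrite /metric_app -row_mul mulmx_ker.
by rewrite row0 mul0mx mxE ltxx.
Qed.

Lemma codom_at : chart_codom c u.
Proof. by exists x => //; exact: mem_chart_at. Qed.

Lemma metric_derivable v : derivable (metric_in g c) u v.
Proof.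
have [gs _ _] := hg; apply: diff_derivable.
have [+ _] := gs c (chart_at_atlas x) 1%N; apply; exact: codom_at.
Qed.

Lemma dmetric_sym a b l : dmetric g c u a b l = dmetric g c u a l b.
Proof.
have dE i j : dmetric g c u a i j =
    'D_(delta_mx 0 a) (fun w => metric_in g c w i j) u.
  rewrite /dmetric derive_mx; last exact: metric_derivable.
  by rewrite mxE.
rewrite !dE; congr (derive _ _ _); apply/funext => w.
by rewrite -[in LHS]metric_in_sym [LHS]mxE.
Qed.

(** The connection is torsion-free and [g] is parallel: these two properties
    characterize the Levi-Civita connection. *)
Lemma christoffel_sym a b k :
  christoffel g c u a b k = christoffel g c u b a k.
Proof.
rewrite /christoffel; have := dmetric_sym; move: (dmetric g c u) => D Dsym.
congr (_ * _); apply: eq_bigr => l _; congr (_ * _).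
by rewrite (Dsym l a b) (addrC (D a b l)).
Qed.

Lemma christoffel_metric a : let C := connection_mx g c u (delta_mx 0 a) in
  dmetric g c u a = C *m g x + g x *m C^T.
Proof.
set C := connection_mx _ _ _ _ => /=.
have CE b m : (C *m g x) b m = 2^-1 *
   (dmetric g c u a b m + dmetric g c u b a m - dmetric g c u m a b).
  rewrite /C /connection_mx /christoffel metric_inE.
  move: (dmetric g c u) => D.
  pose S := \row_l (D a b l + D b a l - D l a b).
  transitivity ((2^-1 *: (S *m invmx (g x) *m g x)) 0 m); last first.
    by rewrite mulmxKV ?metric_unit// !mxE.
  rewrite scalemxAl [LHS]mxE [RHS]mxE; apply: eq_bigr => k _; congr (_ * _).
  rewrite !mxE [LHS](bigD1 a)//= [X in _ + X]big1 => [|a' na]; last first.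
    by rewrite mxE (negbTE na) mul0r.
  rewrite mxE !eqxx mul1r addr0; congr (_ * _).
  by apply: eq_bigr => l _; rewrite mxE.
have gT : (g x)^T = g x by rewrite -metric_inE metric_in_sym.
rewrite -{2}gT -trmx_mul; apply/matrixP => b m; rewrite mxE [X in _ + X]mxE !CE.
move: (dmetric g c u) dmetric_sym => D Dsym; rewrite (Dsym a m b) -mulrDr.
by rewrite ?(Dsym m b a) ?(Dsym m a b); field.
Qed.

(** The Leibniz rule (nabla_v phi) Y = nabla_v (phi Y) - phi (nabla_v Y). *)
Lemma nabla_endoE (Y : M -> 'rV[R]_d) (v : 'rV[R]_d) :
  smooth_endo phi -> derivable (vector_in Y c) u v ->
  Y x *m nabla_endo g phi x v =
    nabla_vector g (fun y => Y y *m phi y) x v - nabla_vector g Y x v *m phi x.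
Proof.
move=> sphi dY.
have dphi : derivable (endo_in phi c) u v.
  apply: diff_derivable; have [+ _] := sphi c (chart_at_atlas x) 1%N.
  by apply; exact: codom_at.
have cx : chart_dom c x := mem_chart_at x.
have ac : atlas c := chart_at_atlas x.
have Yx : vector_in Y c u = Y x.
  by rewrite /vector_in /u chart_mapK// tangent_change_id// mulmx1.
have px : endo_in phi c u = phi x.
  by rewrite /endo_in /u chart_mapK// tangent_change_id// mulmx1 mul1mx.
have nE : \forall w \near u, vector_in Y c w *m endo_in phi c w =
    vector_in (fun y => Y y *m phi y) c w.
  have := chart_inv_dom_near cx cx; apply: filterS => w cw.
  rewrite /vector_in /endo_in !mulmxA; congr (_ *m _ *m _).
  rewrite -mulmxA tangent_changeK ?mulmx1//.
  - exact: chart_at_atlas.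
  - exact: mem_chart_at.
rewrite /nabla_endo /nabla_vector -/c -/u -(near_eq_derive _ nE).
have [_ ->] := is_derive_mulmx dY dphi; rewrite Yx px.
rewrite mulmxBr mulmxDr mulmxDl !mulmxA opprD [RHS]addrA; congr (_ - _).
by rewrite [RHS]addrC [RHS]addrA addKr.
Qed.

End At.
End Facts.

(* Main.v *)
Require Import Defs.
From mathcomp Require Import all_boot all_order all_algebra.
From mathcomp Require Import all_classical all_reals all_analysis.
From mathcomp Require Import ring lra.
Import Order.TTheory GRing.Theory Num.Theory.
Import numFieldNormedType.Exports.
Local Open Scope classical_set_scope.
Local Open Scope ring_scope.

Set Implicit Arguments.
Unset Strict Implicit.
Unset Printing Implicit Defensive.

(** Write sigma = eta(T), w = sqrt(1 - sigma^2), and a = g(N, phi T),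
    b = g(N, xi).  Pairing the Frenet equations with phi T and xi gives a
    first-order system for (sigma, a, b).  As p is constant, it yields
    alpha + p sigma / w + p q' / (p^2 + q^2) = eps tau with eps = 1 or -1,
    while the hypothesis reads tau = |Y| with Y = l1 alpha + l2 beta + l3.  At
    the point where sigma = sigma' = sigma'' = 0 the left-hand side equals Y,
    and eps Y does not vanish on I unless tau = 0 identically, so eps tau = Y
    on I by the intermediate value theorem.  The resulting equation is
    sigma'' = G sigma with G continuous, hence sigma = 0. *)

(** * Covariant differentiation along a curve *)

Lemma is_derive_comp_curve (R : realType) (V W : normedModType R)
    (f : V -> W) (h : R -> V) (s : R) :
  differentiable f (h s) -> derivable h s 1 ->
  is_derive s 1 (f \o h) ('D_('D_1 h s) f (h s)).
Proof.
move=> df /derivable1_diffP dh.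
have dfh : differentiable (f \o h) s by exact: differentiable_comp.
apply: DeriveDef; first exact: diff_derivable.
by rewrite !deriveE// diff_comp.
Qed.

Lemma is_derive_trmx (R : realType) (V : normedModType R) (m n : nat)
    (A : V -> 'M[R]_(m, n)) (u v : V) :
  derivable A u v -> is_derive u v (fun w => (A w)^T) ('D_v A u)^T.
Proof.
move=> dA; have dAe := (derivable_mxP _ _ _).1 dA.
have dT : derivable (fun w => (A w)^T) u v.
  apply/derivable_mxP => i j.
  rewrite (_ : (fun _ => _) = fun w => A w j i)//.
  by apply/funext => w; rewrite mxE.
apply: DeriveDef => //; rewrite (derive_mx dT); apply/matrixP => i j.
rewrite mxE (derive_mx dA) [RHS]mxE.
rewrite (_ : (fun _ => _) = fun w => A w j i); last first.
  by apply/funext => w; rewrite mxE.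
by rewrite mxE.
Qed.

Lemma is_derive_mx_entry (R : realType) (V : normedModType R) (m n : nat)
    (A : V -> 'M[R]_(m, n)) (dA : 'M[R]_(m, n)) (u v : V) i j :
  is_derive u v A dA -> is_derive u v (fun w => A w i j) (dA i j).
Proof.
move=> [hA <-]; apply: DeriveDef; first exact: (derivable_mxP _ _ _).1.
by rewrite derive_mx// mxE.
Qed.

(** Vectors change chart by [J] and Gram matrices by its inverse [K]. Pairings along a curve can
    thus be computed in one fixed chart near a given parameter. *)
Lemma bilinear_change_frame (R : comNzRingType) (m n : nat)
    (v w : 'M[R]_(m, n)) (J K g : 'M[R]_n) : J *m K = 1%:M ->
  v *m J *m (K *m g *m K^T) *m (w *m J)^T = v *m g *m w^T.
Proof.
move=> JK; rewrite -!mulmxA -trmx_mul -(mulmxA w) JK mulmx1.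
by rewrite (mulmxA J K) JK mul1mx.
Qed.

Lemma endo_change_frame (R : comNzRingType) (m n : nat)
    (v : 'M[R]_(m, n)) (J K P : 'M[R]_n) : J *m K = 1%:M ->
  v *m J *m (K *m P *m J) = v *m P *m J.
Proof. by move=> JK; rewrite !mulmxA -(mulmxA v J) JK mulmx1. Qed.

Section AlongCurve.
Variables (R : realType) (d : nat) (M : smooth_manifold R d).

Lemma connection_mxE (g : M -> 'M[R]_d) (c : chart R d M) (u v : 'rV[R]_d) :
  connection_mx g c u v =
    \sum_(a < d) v 0 a *: connection_mx g c u (delta_mx 0 a).
Proof.
apply/matrixP => i j; rewrite !mxE summxE; apply: eq_bigr => a _.
rewrite !mxE [X in _ = _ * X](bigD1 a)//= big1 => [|b nb].
  by rewrite mxE !eqxx mul1r addr0.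
by rewrite mxE (negbTE nb) andbF mul0r.
Qed.

(** Both sides are linear in [v], so [christoffel_metric] for the coordinate directions suffices. *)
Lemma metric_parallel (g : M -> 'M[R]_d) (x : M) (v : 'rV[R]_d) :
  riemannian_metric g ->
  let c := chart_at x in let u := chart_map c x in
  let C := connection_mx g c u v in
  'D_v (metric_in g c) u = C *m g x + g x *m C^T.
Proof.
move=> hg c u C; have [gs _ _] := hg.
have dg : differentiable (metric_in g c) u.
  have [+ _] := gs c (chart_at_atlas x) 1%N; apply; exact: codom_at.
rewrite deriveE// {1}(row_sum_delta v) linear_sum/= /C connection_mxE.
rewrite mulmx_suml linear_sum mulmx_sumr -big_split/=; apply: eq_bigr => a _.
rewrite linearZ/= -deriveE// -/(dmetric _ _ _ _) christoffel_metric//.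
by rewrite linearZ/= -scalemxAl -scalemxAr scalerDr.
Qed.

Lemma endo_inE (phi : M -> 'M[R]_d) (x : M) :
  endo_in phi (chart_at x) (chart_map (chart_at x) x) = phi x.
Proof.
have cx : chart_dom (chart_at x) x := mem_chart_at x.
have ac : atlas (chart_at x) := chart_at_atlas x.
by rewrite /endo_in chart_mapK// tangent_change_id// mulmx1 mul1mx.
Qed.

Variables (I : set R) (gamma : R -> M).
Hypothesis sg : smooth_curve I gamma.

Lemma chart_dom_near_curve (s : R) (c : chart R d M) : I s ->
  chart_dom c (gamma s) -> \forall t \near s, chart_dom c (gamma t).
Proof.
move=> Is cs; have [cg _] := sg; apply: (cg s Is).
by apply: open_nbhs_nbhs; split => //; exact: open_chart_dom.
Qed.

Lemma curve_coord_derivable (s : R) : I s ->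
  derivable (chart_map (chart_at (gamma s)) \o gamma) s 1.
Proof.
move=> Is; have [_ /(_ _ (chart_at_atlas (gamma s)) 1%N)[+ _]] := sg.
move=> dg; apply: diff_derivable; apply: dg.
by split => //; exact: mem_chart_at.
Qed.

Lemma is_derive_field_curve (W : normedModType R) (F : 'rV[R]_d -> W) (s : R) :
  I s -> let c := chart_at (gamma s) in
  smooth_on (chart_codom c) F ->
  is_derive s 1 (fun t => F (chart_map c (gamma t)))
    ('D_(velocity gamma s) F (chart_map c (gamma s))).
Proof.
move=> Is c sF; have [dF _] := sF 1%N.
rewrite /velocity derive1E.
apply: (@is_derive_comp_curve _ _ _ F (chart_map c \o gamma)).
  by apply: dF; exists (gamma s) => //; exact: mem_chart_at.
exact: curve_coord_derivable.
Qed.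

(** The components [V t] refer to the chart preferred at [gamma t], which may jump with [t]; they
    are therefore first transported to the single chart preferred at [gamma s]. *)
Definition along_derivable (V : R -> 'rV[R]_d) (s : R) :=
  derivable (along_in gamma V (chart_at (gamma s))) s 1.

Lemma along_in_self (V : R -> 'rV[R]_d) s :
  along_in gamma V (chart_at (gamma s)) s = V s.
Proof.
rewrite /along_in tangent_change_id ?mulmx1//.
- exact: chart_at_atlas.
- exact: mem_chart_at.
Qed.

Lemma smooth_along_derivable (V : R -> 'rV[R]_d) s :
  smooth_along I gamma V -> I s -> along_derivable V s.
Proof.
move=> sV Is; have [+ _] := sV _ (chart_at_atlas (gamma s)) 1%N.
move=> dV; apply: diff_derivable; apply: dV; split => //; exact: mem_chart_at.
Qed.

(** In the chart at [gamma s] the pairing is a product of three matrices. The derivative of the Gram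
    matrix, given by [metric_parallel], supplies exactly the connection terms of the two covariant
    derivatives. *)
Lemma is_derive_metric_along (g : M -> 'M[R]_d) (V W : R -> 'rV[R]_d) (s : R) :
  riemannian_metric g -> I s -> along_derivable V s -> along_derivable W s ->
  is_derive s 1 (fun t => metric_app g (gamma t) (V t) (W t))
    (metric_app g (gamma s) (nabla_along g gamma V s) (W s)
     + metric_app g (gamma s) (V s) (nabla_along g gamma W s)).
Proof.
move=> hg Is dV dW; pose c := chart_at (gamma s).
have cs : chart_dom c (gamma s) := mem_chart_at _.
have ac : atlas c := chart_at_atlas _.
pose A := along_in gamma V c; pose B := along_in gamma W c.
pose G t := metric_in g c (chart_map c (gamma t)).
have [gs _ _] := hg.
have dG : is_derive s 1 G _ := is_derive_field_curve Is (gs c ac).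
have nE : \forall t \near s,
    (A t *m G t *m (B t)^T) 0 0 = metric_app g (gamma t) (V t) (W t).
  have := chart_dom_near_curve Is cs; apply: filterS => t ct.
  rewrite /A /B /G /along_in /metric_in /metric_app chart_mapK//.
  have tK : tangent_change (chart_at (gamma t)) c (gamma t) *m
      tangent_change c (chart_at (gamma t)) (gamma t) = 1%:M.
    apply: tangent_changeK => //; first exact: chart_at_atlas.
    exact: mem_chart_at.
  by rewrite bilinear_change_frame.
apply: near_eq_is_derive nE _.
have dAG := is_derive_mulmx dV (@ex_derive _ _ _ _ _ _ _ dG).
have dBT := is_derive_trmx dW.
have dAGB := is_derive_mulmx (@ex_derive _ _ _ _ _ _ _ dAG)
  (@ex_derive _ _ _ _ _ _ _ dBT).
apply: is_derive_eq; first exact: (is_derive_mx_entry 0 0 dAGB).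
have [_ ->] := dAG; have [_ ->] := dBT; have [_ ->] := dG.
have As : A s = V s by exact: along_in_self.
have Bs : B s = W s by exact: along_in_self.
have Gs : G s = g (gamma s) by exact: metric_inE.
rewrite metric_parallel//.
rewrite -/A -/B Gs As Bs /nabla_along -/c !derive1E -/A -/B /metric_app.
have mxD (X Y : 'M[R]_1) : X 0 0 + Y 0 0 = (X + Y) 0 0 by rewrite mxE.
rewrite mxD; congr (fun_of_matrix _ 0 0).
rewrite !(linearD, mulmxDl, mulmxDr, trmx_mul, mulmxA)/=.
by rewrite trmx_mul !mulmxA -!addrA; congr (_ + (_ + _)); rewrite addrC.
Qed.

(** The Leibniz rule along a curve, where [V] need not extend to a field on [M]. The term of
    [nabla_endo] in which the connection acts before [phi] cancels against the connection term of
    [nabla_along g gamma V]. *)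
Lemma nabla_along_endo (g phi : M -> 'M[R]_d) (V : R -> 'rV[R]_d) (s : R) :
  smooth_endo phi -> I s -> along_derivable V s ->
  along_derivable (fun t => V t *m phi (gamma t)) s /\
  nabla_along g gamma (fun t => V t *m phi (gamma t)) s =
    V s *m nabla_endo g phi (gamma s) (velocity gamma s)
    + nabla_along g gamma V s *m phi (gamma s).
Proof.
move=> sphi Is dV; pose c := chart_at (gamma s).
have cs : chart_dom c (gamma s) := mem_chart_at _.
have ac : atlas c := chart_at_atlas _.
pose A := along_in gamma V c; pose P t := endo_in phi c (chart_map c (gamma t)).
have dP : is_derive s 1 P _ := is_derive_field_curve Is (sphi c ac).
have nE : \forall t \near s,
    A t *m P t = along_in gamma (fun t => V t *m phi (gamma t)) c t.
  have := chart_dom_near_curve Is cs; apply: filterS => t ct.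
  rewrite /A /P /along_in /endo_in chart_mapK//.
  have tK : tangent_change (chart_at (gamma t)) c (gamma t) *m
      tangent_change c (chart_at (gamma t)) (gamma t) = 1%:M.
    apply: tangent_changeK => //; first exact: chart_at_atlas.
    exact: mem_chart_at.
  by rewrite endo_change_frame.
have dAP := is_derive_mulmx dV (@ex_derive _ _ _ _ _ _ _ dP).
have dVP := near_eq_is_derive nE dAP.
split; first exact: (@ex_derive _ _ _ _ _ _ _ dVP).
have [_ dE] := dVP; have [_ dPE] := dP.
have As : A s = V s by exact: along_in_self.
have Ps : P s = phi (gamma s) by exact: endo_inE.
rewrite /nabla_along -/c !derive1E dE dPE -/A As Ps /nabla_endo -/c.
rewrite mulmxBr !mulmxDr mulmxDl !mulmxA.
by rewrite [X in _ = _ + X]addrC [RHS]addrA subrK -addrA addrC.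
Qed.

Lemma along_derivable_field (X : M -> 'rV[R]_d) (s : R) :
  smooth_vector X -> I s -> along_derivable (X \o gamma) s.
Proof.
move=> sX Is; pose c := chart_at (gamma s).
have cs : chart_dom c (gamma s) := mem_chart_at _.
have ac : atlas c := chart_at_atlas _.
have dX := is_derive_field_curve Is (sX c ac).
have nE : \forall t \near s, vector_in X c (chart_map c (gamma t)) =
    along_in gamma (X \o gamma) c t.
  have := chart_dom_near_curve Is cs; apply: filterS => t ct.
  by rewrite /vector_in chart_mapK.
exact: (@ex_derive _ _ _ _ _ _ _ (near_eq_is_derive nE dX)).
Qed.

(** A Frenet frame is tied to the velocity on [I] only; locality allows one to replace the other
    under the covariant derivative. *)
Lemma near_nabla_along (g : M -> 'M[R]_d) (V W : R -> 'rV[R]_d) (s : R) :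
  (\forall t \near s, V t = W t) ->
  nabla_along g gamma V s = nabla_along g gamma W s.
Proof.
move=> nE; rewrite /nabla_along (nbhs_singleton nE); congr (_ + _).
rewrite !derive1E; apply: near_eq_derive.
by move: nE; apply: filterS => t VW; rewrite /along_in VW.
Qed.

Lemma near_along_derivable (V W : R -> 'rV[R]_d) (s : R) :
  (\forall t \near s, V t = W t) ->
  along_derivable V s -> along_derivable W s.
Proof.
move=> nE; apply: near_eq_derivable.
by move: nE; apply: filterS => t VW; rewrite /along_in VW.
Qed.

Lemma nabla_along0 (g : M -> 'M[R]_d) (s : R) :
  nabla_along g gamma (fun=> 0) s = 0.
Proof.
rewrite /nabla_along mul0mx addr0 derive1E.
rewrite (_ : along_in _ _ _ = cst 0) ?derive_cst//.
by apply/funext => t; rewrite /along_in mul0mx.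
Qed.

Lemma derivable_function_along (f : M -> R) (s : R) :
  smooth_function f -> I s -> derivable (f \o gamma) s 1.
Proof.
move=> sf Is; pose c := chart_at (gamma s).
have cs : chart_dom c (gamma s) := mem_chart_at _.
have ac : atlas c := chart_at_atlas _.
have df := is_derive_field_curve Is (sf c ac).
apply: (near_eq_derivable _ (@ex_derive _ _ _ _ _ _ _ df)).
have := chart_dom_near_curve Is cs; apply: filterS => t ct.
by rewrite /= chart_mapK.
Qed.

Hypothesis oI : open I.

(** Smoothness in a chart gives continuity of the derivative in a fixed direction, whereas the
    velocity varies. Hence the derivative is expanded over the coordinate directions into a finite
    sum of products of continuous functions. *)
Lemma continuous_derive_function_along (f : M -> R) (s : R) :
  smooth_function f -> I s -> {for s, continuous (derive1 (f \o gamma))}.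
Proof.
move=> sf Is; pose c := chart_at (gamma s).
have cs : chart_dom c (gamma s) := mem_chart_at _.
have ac : atlas c := chart_at_atlas _.
pose F := f \o chart_inv c; pose h := chart_map c \o gamma.
have [dF cF] := sf c ac 1%N; have [cg /(_ c ac 1%N)[dh ch]] := sg.
have near_s : \forall t \near s, I t /\ chart_dom c (gamma t).
  have := chart_dom_near_curve Is cs.
  have : \forall t \near s, I t by exact: open_nbhs_nbhs.
  by apply: filterS2.
have dE t : I t -> chart_dom c (gamma t) -> derive1 (f \o gamma) t =
    \sum_(a < d) 'D_1 h t 0 a * 'D_(delta_mx 0 a) F (h t).
  move=> It ct; rewrite derive1E.
  have nE : \forall t' \near t, F (h t') = (f \o gamma) t'.
    have := chart_dom_near_curve It ct; apply: filterS => t' ct'.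
    by rewrite /F /h /= chart_mapK.
  have dFt : differentiable F (h t) by apply: dF; exists (gamma t).
  have dht : derivable h t 1 by apply: diff_derivable; apply: dh.
  have [_ ->] := near_eq_is_derive nE (is_derive_comp_curve dFt dht).
  rewrite deriveE// {1}(row_sum_delta ('D_1 h t)) linear_sum.
  by apply: eq_bigr => a _; rewrite linearZ/= -deriveE.
have nE' : \forall t \near s,
    \sum_(a < d) 'D_1 h t 0 a * 'D_(delta_mx 0 a) F (h t) =
    derive1 (f \o gamma) t.
  by move: near_s; apply: filterS => t' [It' ct']; rewrite dE.
rewrite /prop_for /continuous_at dE//; apply: cvg_trans (near_eq_cvg nE') _.
apply: cvg_big => [|a _]; first exact: add_continuous.
have hs : {for s, continuous h}.
  by apply: differentiable_continuous; apply: dh.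
apply: cvgM.
  apply: (@cvg_comp _ _ _ ('D_1 h) (fun v : 'rV[R]_d => v 0 a)).
    by apply: ch.
  exact: coord_continuous.
apply: (@cvg_comp _ _ _ h ('D_(delta_mx 0 a) F)); first exact: hs.
by apply: cF; exists (gamma s).
Qed.

End AlongCurve.

(** * Algebra of almost contact metric structures *)

Section MetricApp.
Variables (R : realType) (d : nat) (M : smooth_manifold R d).
Variables (g : M -> 'M[R]_d) (x : M).
Implicit Types u v w : 'rV[R]_d.

Lemma metric_appDl u v w :
  metric_app g x (u + v) w = metric_app g x u w + metric_app g x v w.
Proof. by rewrite /metric_app !mulmxDl mxE. Qed.

Lemma metric_appZl a v w : metric_app g x (a *: v) w = a * metric_app g x v w.
Proof. by rewrite /metric_app -!scalemxAl mxE. Qed.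

Lemma metric_appNl v w : metric_app g x (- v) w = - metric_app g x v w.
Proof. by rewrite /metric_app !mulNmx mxE. Qed.

Lemma metric_app0l w : metric_app g x 0 w = 0.
Proof. by rewrite /metric_app !mul0mx mxE. Qed.

Lemma metric_mulmxE m n (A : 'M[R]_(m, d)) (B : 'M[R]_(n, d)) i j :
  (A *m g x *m B^T) i j = metric_app g x (row i A) (row j B).
Proof.
rewrite /metric_app !mxE; apply: eq_bigr => k _; rewrite !mxE.
by congr (_ * _); apply: eq_bigr => l _; rewrite mxE.
Qed.

Hypothesis hg : riemannian_metric g.

Lemma metric_appC v w : metric_app g x v w = metric_app g x w v.
Proof. by have [_ + _] := hg; apply. Qed.

Lemma metric_appDr u v w :
  metric_app g x u (v + w) = metric_app g x u v + metric_app g x u w.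
Proof. by rewrite !(metric_appC u) metric_appDl. Qed.

Lemma metric_appZr a v w : metric_app g x v (a *: w) = a * metric_app g x v w.
Proof. by rewrite !(metric_appC v) metric_appZl. Qed.

Lemma metric_appNr v w : metric_app g x v (- w) = - metric_app g x v w.
Proof. by rewrite !(metric_appC v) metric_appNl. Qed.

Lemma metric_app_eq0 v : metric_app g x v v = 0 -> v = 0.
Proof.
move=> v0; apply/eqP/negPn/negP => vn0.
by have [_ _ /(_ x v vn0)] := hg; rewrite v0 ltxx.
Qed.

Definition metric_appE :=
  (metric_appDl, metric_appDr, metric_appZl, metric_appZr, metric_appNl,
   metric_appNr).

(* The matrix [P] of an orthonormal family satisfies [P g P^T = 1], so
   [g P^T P = 1] as [P] is square. *)
Lemma parseval (e : 'I_d -> 'rV[R]_d) v :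
  (forall i j, metric_app g x (e i) (e j) = (i == j)%:R) ->
  metric_app g x v v = \sum_(i < d) metric_app g x v (e i) ^+ 2.
Proof.
move=> eo; pose P := \matrix_i e i.
have PgP : P *m (g x *m P^T) = 1%:M.
  by apply/matrixP => i j; rewrite mulmxA metric_mulmxE !rowK eo mxE.
transitivity (((v *m g x *m P^T) *m (P *m g x *m v^T)) 0 0).
  by rewrite !mulmxA -(mulmxA v) -(mulmxA v) (mulmx1C PgP) mulmx1.
rewrite mxE; apply: eq_bigr => i _.
by rewrite !metric_mulmxE !row_id rowK (metric_appC (e i)) expr2.
Qed.

End MetricApp.

Section AlmostContact.
Variables (R : realType) (d : nat) (M : smooth_manifold R d).
Variables (phi : M -> 'M[R]_d) (xi : M -> 'rV[R]_d) (eta : M -> 'cV[R]_d).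
Variables (g : M -> 'M[R]_d).
Hypothesis hc : almost_contact_metric phi xi eta g.
Let hg : riemannian_metric g := acm_metric hc.
Implicit Types (x : M) (v w : 'rV[R]_d).

Lemma acm_g_xi_xi x : metric_app g x (xi x) (xi x) = 1.
Proof. by rewrite (acm_g_xi hc) (acm_eta_xi hc). Qed.

(** By compatibility its squared length is 1 - 1. *)
Lemma acm_phi_xi x : xi x *m phi x = 0.
Proof.
apply: (metric_app_eq0 hg (x := x)).
by rewrite (acm_compat hc) acm_g_xi_xi (acm_eta_xi hc) mulr1 subrr.
Qed.

(** Computing the cube of [phi] on [v] in two ways leaves eta(phi v) xi = 0, and [xi] does not
    vanish. *)
Lemma acm_eta_phi x v : form_app eta x (v *m phi x) = 0.
Proof.
have xi0 : xi x != 0.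
  apply/eqP => xi0; have := acm_g_xi_xi x.
  by rewrite xi0 metric_app0l => /eqP; rewrite eq_sym oner_eq0.
have := acm_phi2 hc x (v *m phi x).
rewrite (acm_phi2 hc x v) mulmxDl mulNmx -scalemxAl acm_phi_xi scaler0 addr0.
move/eqP; rewrite -subr_eq0 opprD addrA subrr add0r oppr_eq0 scaler_eq0.
by rewrite (negbTE xi0) orbF => /eqP.
Qed.

(** Compatibility applied to phi v and w, where phi^2 v = - v + eta(v) xi and xi is orthogonal to
    phi w. *)
Lemma acm_phi_skew x v w :
  metric_app g x (v *m phi x) w = - metric_app g x v (w *m phi x).
Proof.
have := acm_compat hc x (v *m phi x) w.
rewrite acm_eta_phi mul0r subr0 => <-.
rewrite (acm_phi2 hc) !(metric_appE _ hg) (metric_appC _ hg (xi x)).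
by rewrite (acm_g_xi hc) acm_eta_phi mulr0 addr0.
Qed.

Lemma acm_g_phi_self x v : metric_app g x (v *m phi x) v = 0.
Proof.
have := acm_phi_skew x v v; rewrite (metric_appC _ hg v) => h.
by lra.
Qed.

End AlmostContact.

(** * Covariant derivatives of xi and phi T along a curve in a trans-Sasakian manifold *)

Section TransSasakianCurve.
Variables (R : realType) (d : nat) (M : smooth_manifold R d).
Variables (phi : M -> 'M[R]_d) (xi : M -> 'rV[R]_d) (eta : M -> 'cV[R]_d).
Variables (g : M -> 'M[R]_d) (alpha beta : M -> R).
Hypothesis ts : trans_sasakian phi xi eta g alpha beta.
Let hc : almost_contact_metric phi xi eta g := ts_acm ts.
Let hg : riemannian_metric g := acm_metric hc.
Variables (I : set R) (gamma : R -> M).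
Hypothesis sg : smooth_curve I gamma.
Local Notation T := (velocity gamma).
Local Notation G s := (metric_app g (gamma s)).

(** Differentiating phi xi = 0 determines phi applied to the derivative of xi. Applying phi once
    more recovers the derivative itself, because it is orthogonal to xi. *)
Lemma nabla_xi_along s : I s ->
  nabla_along g gamma (xi \o gamma) s =
    - alpha (gamma s) *: (T s *m phi (gamma s))
    + beta (gamma s) *: (T s - form_app eta (gamma s) (T s) *: xi (gamma s)).
Proof.
move=> Is; have dxi := along_derivable_field sg (acm_smooth_xi hc) Is.
set X := nabla_along _ _ _ _.
(* This is the derivative of the constant g(xi, xi) = 1. *)
have X0 : form_app eta (gamma s) X = 0.
  have dE := is_derive_metric_along sg hg Is dxi dxi.
  have d1 : is_derive s 1 (fun t => G t (xi (gamma t)) (xi (gamma t))) 0.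
    rewrite (_ : (fun _ => _) = cst 1); first exact: is_derive_cst.
    by apply/funext => t; rewrite (acm_g_xi_xi hc).
  have [_] := dE; have [_ ->] := d1.
  rewrite -/X /= (metric_appC _ hg (xi _) X) (acm_g_xi hc) => /esym E.
  by lra.
have [_] := nabla_along_endo sg g (acm_smooth_phi hc) Is dxi.
rewrite (_ : (fun t => _) = fun=> 0); last first.
  by apply/funext => t; exact: (acm_phi_xi hc).
rewrite nabla_along0 -/X /= (ts_nabla_phi ts) !(acm_g_xi hc) (acm_eta_phi hc).
rewrite (acm_eta_xi hc) scale0r !scale1r add0r scalerN => /eqP.
rewrite eq_sym addrC addr_eq0 opprD opprK -scalerN opprB => /eqP E.
have : X *m phi (gamma s) *m phi (gamma s) =
    (alpha (gamma s) *: (T s - form_app eta (gamma s) (T s) *: xi (gamma s)) +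
     beta (gamma s) *: (T s *m phi (gamma s))) *m phi (gamma s).
  by rewrite E.
rewrite (acm_phi2 hc) X0 scale0r addr0 mulmxDl -!scalemxAl mulmxBl -scalemxAl.
rewrite (acm_phi_xi hc) scaler0 subr0 (acm_phi2 hc) => /(congr1 -%R).
by rewrite opprK opprD -scaleNr -[in X in _ + X]scalerN opprD opprK => ->.
Qed.

Lemma nabla_phi_velocity s : I s -> along_derivable gamma T s ->
  nabla_along g gamma (fun t => T t *m phi (gamma t)) s =
    alpha (gamma s) *: (G s (T s) (T s) *: xi (gamma s)
      - form_app eta (gamma s) (T s) *: T s)
    - (beta (gamma s) * form_app eta (gamma s) (T s)) *: (T s *m phi (gamma s))
    + nabla_along g gamma T s *m phi (gamma s).
Proof.
move=> Is dT; have [_ ->] := nabla_along_endo sg g (acm_smooth_phi hc) Is dT.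
rewrite (ts_nabla_phi ts) (acm_g_phi_self hc) scale0r add0r scalerN scalerA.
by [].
Qed.

End TransSasakianCurve.

(** * Ordinary differential equations *)

Section Interval.
Variables (R : realType) (I : set R).
Hypothesis iI : is_interval I.

Lemma subset_interval (a b : R) : I a -> I b ->
  forall t, t \in `[a, b]%R -> I t.
Proof. by move=> Ia Ib t; rewrite in_itv/=; exact: iI. Qed.

Lemma continuous_within_interval (f : R -> R) (a b : R) :
  (forall s, I s -> {for s, continuous f}) -> I a -> I b ->
  {within `[a, b], continuous f}.
Proof.
move=> cf Ia Ib; apply: continuous_in_subspaceT => t tab.
by apply: cf; apply: (subset_interval Ia Ib); rewrite inE in tab.
Qed.

Lemma continuous_neq0_gt0 (h : R -> R) (s0 : R) :
  (forall s, I s -> {for s, continuous h}) -> (forall s, I s -> h s != 0) ->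
  I s0 -> 0 < h s0 -> forall s, I s -> 0 < h s.
Proof.
move=> ch h0 Is0 hs0 s Is; rewrite lt_neqAle eq_sym h0//= leNgt.
apply/negP => hs.
have [ab|ab] := leP s s0.
  have [|c cab hc0] := @IVT _ _ _ _ 0 ab (continuous_within_interval ch Is Is0).
    by rewrite ge_min le_max (ltW hs) (ltW hs0) orbT.
  by move: (h0 c (subset_interval Is Is0 cab)); rewrite hc0 eqxx.
have [|c cab hc0] :=
    @IVT _ _ _ _ 0 (ltW ab) (continuous_within_interval ch Is0 Is).
  by rewrite ge_min le_max (ltW hs) (ltW hs0) orbT.
by move: (h0 c (subset_interval Is0 Is cab)); rewrite hc0 eqxx.
Qed.

(* Gronwall's argument for the energy [y ^+ 2 + y1 ^+ 2]. *)
Lemma linear_ode2_eq0 (y y1 G : R -> R) (s0 : R) :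
  (forall s, I s -> is_derive s 1 y (y1 s)) ->
  (forall s, I s -> is_derive s 1 y1 (G s * y s)) ->
  (forall s, I s -> {for s, continuous G}) ->
  I s0 -> y s0 = 0 -> y1 s0 = 0 -> forall s, I s -> y s = 0.
Proof.
move=> dy dy1 cG Is0 y0 y10 s Is.
pose e t := y t ^+ 2 + y1 t ^+ 2.
have e0 : e s0 = 0 by rewrite /e y0 y10 expr0n addr0.
suff es : e s <= 0.
  apply/eqP; rewrite -sqrf_eq0 eq_le sqr_ge0 andbT (le_trans _ es)//.
  by rewrite lerDl sqr_ge0.
(* The energy satisfies |e'| <= K e on a compact interval. The exponential weight turns this into
   monotonicity, with c = - K to the right of [s0] and c = K to the left. *)
have dF (c t : R) : I t -> is_derive t 1 (fun t => expR (c * t) * e t)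
    (expR (c * t) * (c * e t + 2 * y t * y1 t * (1 + G t))).
  move=> It; have d1 := dy t It; have d2 := dy1 t It.
  apply: is_derive_eq; rewrite /e /GRing.scale/=; ring.
have dFb (c a b : R) : a <= b -> I a -> I b ->
    (forall t, t \in `]a, b[%R ->
      derivable (fun t => expR (c * t) * e t) t 1) /\
    {within `[a, b], continuous (fun t => expR (c * t) * e t)}.
  move=> ab Ia Ib; split=> [t tab|].
    have It : I t by apply: (subset_interval Ia Ib); exact: subset_itv_oo_cc.
    exact: (@ex_derive _ _ _ _ _ _ _ (dF c t It)).
  apply: continuous_within_interval => // t It.
  apply/differentiable_continuous/derivable1_diffP.
  exact: (@ex_derive _ _ _ _ _ _ _ (dF c t It)).
(* K is the maximum of |1 + G| on [a, b], and 2 |y y1| <= e. *)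
have bnd a b : a <= b -> I a -> I b -> exists K : R, forall t,
    t \in `]a, b[%R -> `|2 * y t * y1 t * (1 + G t)| <= K * e t.
  move=> ab Ia Ib.
  have [c _ Gc] : exists2 c : R, c \in `[a, b]%R &
      forall t, t \in `[a, b]%R -> `|1 + G t| <= `|1 + G c|.
    apply: EVT_max => //; apply: continuous_within_interval => // t It.
    apply: (@continuous_comp _ _ _ (fun t => 1 + G t) (fun x : R => `|x|)).
      by apply: cvgD; [exact: cvg_cst|exact: cG].
    exact: norm_continuous.
  exists `|1 + G c| => t tab; rewrite normrM mulrC ler_pM ?normr_ge0//.
    by apply: Gc; exact: subset_itv_oo_cc.
  rewrite ler_norml /e; have := sqr_ge0 (y t + y1 t).
  by have := sqr_ge0 (y t - y1 t); nra.
have [ab|ab] := leP s0 s.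
  have [K bK] := bnd _ _ ab Is0 Is; have [dK cK] := dFb (- K) _ _ ab Is0 Is.
  have : expR (- K * s) * e s <= expR (- K * s0) * e s0.
    apply: (ler0_derive1_le_cc dK _ cK); rewrite ?in_itv/= ?lexx ?ab// => t tab.
    have It : I t by apply: (subset_interval Is0 Is); exact: subset_itv_oo_cc.
    rewrite derive1E; have [_ ->] := dF (- K) t It.
    rewrite pmulr_rle0 ?expR_gt0// mulNr addrC subr_le0.
    exact: le_trans (ler_norm _) (bK t tab).
  by rewrite e0 mulr0 pmulr_rle0 ?expR_gt0.
have {}ab := ltW ab.
have [K bK] := bnd _ _ ab Is Is0; have [dK cK] := dFb K _ _ ab Is Is0.
have : expR (K * s) * e s <= expR (K * s0) * e s0.
  apply: (ger0_derive1_le_cc dK _ cK); rewrite ?in_itv/= ?lexx ?ab// => t tab.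
  have It : I t by apply: (subset_interval Is Is0); exact: subset_itv_oo_cc.
  rewrite derive1E; have [_ ->] := dF K t It.
  rewrite pmulr_rge0 ?expR_gt0// -lerBlDl sub0r.
  by have := bK t tab; rewrite ler_norml => /andP[].
by rewrite e0 mulr0 pmulr_rle0 ?expR_gt0.
Qed.

End Interval.

(** * Continuity tools and the scalar system of a Frenet curve *)

Lemma cvg_sqr (R : realType) (f : R -> R) (s l : R) :
  f x @[x --> s] --> l -> f x ^+ 2 @[x --> s] --> l ^+ 2.
Proof. by move=> fl; apply: cvgM. Qed.

Lemma is_derive_continuous (R : realType) (f : R -> R) (s df : R) :
  is_derive s 1 f df -> {for s, continuous f}.
Proof.
by move=> [fs _]; apply/differentiable_continuous/derivable1_diffP.
Qed.

(** Descends along the syntax of the expected limit, closing the atoms from the context; the goals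
    that remain say that the denominators do not vanish. *)
Ltac prove_cvg :=
  cbv beta;
  lazymatch goal with
  | |- cvg_to _ (nbhs ?l) =>
    lazymatch l with
    | Algebra.add _ _ => apply: cvgD; prove_cvg
    | Algebra.opp _ => apply: cvgN; prove_cvg
    | GRing.mul _ _ => apply: cvgM; prove_cvg
    | GRing.inv _ => apply: cvgV; prove_cvg
    | GRing.exp _ _ => apply: cvg_sqr; prove_cvg
    | _ => first [assumption | exact: cvg_cst]
    end
  | |- _ => idtac
  end.

(* [a], [b], [u], [v] stand for g(N, phi T), g(N, xi), g(B, phi T), g(B, xi),
   [S] for the derivative of [sigma], [theta] for eps tau and [Y] for
   l1 alpha + l2 beta + l3, where q has been replaced by [kappa b / w] and
   [p ^+ 2 + q ^+ 2] by [kappa ^+ 2]. *)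
Section ScalarSystem.
Variables (R : realType) (I : set R).
Hypotheses (oI : open I) (iI : is_interval I).
Variables (sigma a b u v kappa tau alpha beta : R -> R) (p0 : R).
Let w (t : R) : R := Num.sqrt (1 - sigma t ^+ 2).
Let S (t : R) : R := kappa t * b t + beta t * (1 - sigma t ^+ 2).
Hypothesis p0_neq0 : p0 != 0.
Hypothesis sigma_lt1 : forall s, I s -> sigma s ^+ 2 < 1.
Hypothesis dsigma : forall s, I s -> is_derive s 1 sigma (S s).
Hypothesis da : forall s, I s -> is_derive s 1 a
  (tau s * u s + alpha s * b s - beta s * sigma s * a s).
Hypothesis db : forall s, I s -> is_derive s 1 b
  (tau s * v s - kappa s * sigma s - alpha s * a s - beta s * sigma s * b s).
Hypothesis dkappa : forall s, I s -> derivable kappa s 1.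
Hypothesis dbeta : forall s, I s -> derivable beta s 1.
Hypothesis kappa_gt0 : forall s, I s -> 0 < kappa s.
Hypothesis kappaa : forall s, I s -> kappa s * a s = p0 * w s.
Hypothesis sqr_ab : forall s, I s -> a s ^+ 2 + b s ^+ 2 = 1 - sigma s ^+ 2.
Hypothesis ab_uv : forall s, I s -> a s * u s + b s * v s = 0.

(** The factor of [tau] is the determinant of (N, B) in the orthonormal frame phi T / w, (xi - sigma
    T) / w of the plane orthogonal to T. It is a sign when there is a binormal. *)
Let theta (t : R) : R := tau t * (a t * v t - b t * u t) / (1 - sigma t ^+ 2).

Lemma w_gt0 s : I s -> 0 < w s.
Proof. by move=> Is; rewrite sqrtr_gt0 subr_gt0 sigma_lt1. Qed.

Lemma sqr_w s : I s -> w s ^+ 2 = 1 - sigma s ^+ 2.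
Proof. by move=> Is; rewrite sqr_sqrtr// subr_ge0 ltW// sigma_lt1. Qed.

Lemma is_derive_w s : I s -> is_derive s 1 w (- (sigma s * S s / w s)).
Proof.
move=> Is; have d1 := dsigma Is.
have d2 : is_derive s 1 (fun t => 1 - sigma t ^+ 2) (- (2 * sigma s * S s)).
  by apply: is_derive_eq; rewrite /GRing.scale/=; ring.
have ws := w_gt0 Is.
have d3 : is_derive (1 - sigma s ^+ 2) 1 Num.sqrt (2 * w s)^-1.
  by apply: is_derive1_sqrt; rewrite subr_gt0 sigma_lt1.
have d := @is_derive1_comp _ Num.sqrt (fun t => 1 - sigma t ^+ 2) s _ _ d3 d2.
have -> : - (sigma s * S s / w s) = (2 * w s)^-1 * - (2 * sigma s * S s).
  by field; rewrite gt_eqF.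
exact: d.
Qed.

(** The derivative of [kappa], [u] and [v] are eliminated: the first by differentiating kappa a = p0
    w, the other two in favour of [theta]. *)
Lemma is_derive_S s : I s -> is_derive s 1 S
  (- (kappa s * b s * sigma s * S s / w s ^+ 2) - kappa s ^+ 2 * sigma s
   - (alpha s - theta s) * w s * kappa s ^+ 2 / p0
   + 'D_1 beta s * w s ^+ 2 - 2 * beta s * sigma s * S s).
Proof.
move=> Is; have d1 := dsigma Is; have d2 := da Is; have d3 := db Is.
have d4 := derivableP (dkappa Is); have d5 := derivableP (dbeta Is).
have ws := w_gt0 Is; have ks := kappa_gt0 Is; have w2 := sqr_w Is.
have a0 : a s != 0.
  apply/eqP => a0; have := kappaa Is; rewrite a0 mulr0 => /esym/eqP.
  by rewrite mulf_eq0 (negbTE p0_neq0) gt_eqF.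
(* The constancy of p enters here. *)
have k' : 'D_1 kappa s * a s = - (p0 * sigma s * S s / w s) -
    kappa s * (tau s * u s + alpha s * b s - beta s * sigma s * a s).
  have dk : is_derive s 1 (kappa * a) _ := is_deriveM d4 d2.
  have dw : is_derive s 1 (p0 \*: w) _ := is_deriveZ p0 (is_derive_w Is).
  have nE : \forall t \near s, (p0 \*: w) t = (kappa * a) t.
    have : \forall t \near s, I t by exact: open_nbhs_nbhs.
    by apply: filterS => t It; rewrite /= -[RHS]/(kappa t * a t) kappaa.
  have [_ E1] := near_eq_is_derive nE dw.
  have [_ E2] := dk.
  move: E1; rewrite E2 /GRing.scale/= => /(canRL (addKr _)).
  by rewrite [in LHS]mulrC => ->; ring.
have sw : 1 - sigma s ^+ 2 != 0 by rewrite -w2 expf_neq0// gt_eqF.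
have thetaE : theta s * (1 - sigma s ^+ 2) = tau s * (a s * v s - b s * u s).
  by rewrite /theta divfK.
(* Cramer's rule for the system a u + b v = 0 and tau (a v - b u) = theta w^2, of determinant a^2 +
   b^2 = w^2; [vE] is the other unknown. *)
have uE : tau s * u s = - (theta s * b s).
  apply: (mulIf sw); rewrite mulNr (mulrAC (theta s)) thetaE -sqr_ab//.
  apply/eqP; rewrite -subr_eq0; apply/eqP.
  transitivity (tau s * a s * (a s * u s + b s * v s)); first by ring.
  by rewrite ab_uv// mulr0.
have vE : tau s * v s = theta s * a s.
  apply: (mulIf sw); rewrite (mulrAC (theta s)) thetaE -sqr_ab//.
  apply/eqP; rewrite -subr_eq0; apply/eqP.
  transitivity (tau s * b s * (a s * u s + b s * v s)); first by ring.
  by rewrite ab_uv// mulr0.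
apply: is_derive_eq; rewrite /GRing.scale/= vE.
have -> : 'D_1 kappa s = (- (p0 * sigma s * S s / w s) -
    kappa s * (tau s * u s + alpha s * b s - beta s * sigma s * a s)) / a s.
  by rewrite -k' mulfK.
rewrite uE.
have w0 : w s != 0 by rewrite gt_eqF.
have k0 : kappa s != 0 by rewrite gt_eqF.
have aE : a s = p0 * w s / kappa s by rewrite -kappaa// mulrAC divff ?mul1r.
(* The relations a^2 + b^2 = w^2 and kappa a = p0 w are invisible to [field], so they are built into
   two factors of the goal beforehand. *)
have kw : w s * kappa s ^+ 2 / p0 = kappa s * (a s ^+ 2 + b s ^+ 2) / a s.
  by rewrite sqr_ab// -w2 aE; field; rewrite ?w0 ?k0 p0_neq0.
have kb : kappa s * b s / w s ^+ 2 = b s * p0 / (w s * a s).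
  by rewrite aE; field; rewrite ?w0 ?k0 p0_neq0.
have -> : kappa s * b s * sigma s * S s / w s ^+ 2 =
  kappa s * b s / w s ^+ 2 * sigma s * S s by ring.
rewrite -[(alpha s - theta s) * _ * _ / _]mulrA.
rewrite -(mulrA (alpha s - theta s)) [w s * _]mulrA kw kb w2.
by field; rewrite a0 w0.
Qed.

Hypothesis calpha : forall s, I s -> {for s, continuous alpha}.
Hypothesis cdbeta : forall s, I s -> {for s, continuous (derive1 beta)}.

Let Y (t : R) : R := alpha t / w t
  - p0 * b t * sigma t * beta t / (w t ^+ 2 * kappa t)
  - p0 * derive1 beta t / kappa t ^+ 2.

Hypothesis tauE : forall s, I s -> tau s = `|Y s|.
(** The alternatives are a frame without binormal and one with it. In the second, (u, v) has the
    same length as (a, b). *)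
Hypothesis tau_cases : (forall s, I s -> tau s = 0) \/
  (forall s, I s -> [/\ 0 < tau s, u s ^+ 2 + v s ^+ 2 = 1 - sigma s ^+ 2,
    {for s, continuous u} & {for s, continuous v}]).

Variable s0 : R.
Hypotheses (Is0 : I s0) (sigma0 : sigma s0 = 0) (S0 : S s0 = 0).
Hypothesis dS0 : 'D_1 S s0 = 0.

Lemma w_neq0 s : I s -> w s != 0.
Proof. by move=> Is; rewrite gt_eqF// w_gt0. Qed.

Lemma kappa_neq0 s : I s -> kappa s != 0.
Proof. by move=> Is; rewrite gt_eqF// kappa_gt0. Qed.

(** At [s0] one has w = 1 and [is_derive_S] collapses to 0 = - (alpha - theta) kappa^2 / p0 + beta',
    while the middle term of [Y] vanishes with sigma. *)
Lemma theta_s0 : theta s0 = Y s0.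
Proof.
have w1 : w s0 = 1 by rewrite /w sigma0 expr0n subr0 sqrtr1.
have [_] := is_derive_S Is0; rewrite dS0 S0 sigma0 w1 -derive1E => E.
rewrite /Y sigma0 w1.
have k0 := kappa_neq0 Is0.
have : theta s0 = alpha s0 - p0 * derive1 beta s0 / kappa s0 ^+ 2.
  apply/eqP; rewrite -subr_eq0; apply/eqP.
  have := congr1 ( *%R (p0 / kappa s0 ^+ 2)) E; rewrite mulr0 => E0.
  by apply: etrans (esym E0); field; rewrite k0 p0_neq0.
by move=> ->; field; rewrite k0.
Qed.

(** Both sides have square tau^2, so only a sign has to be fixed; it is propagated from [s0] through
    the continuous function eps Y. *)
Lemma theta_eqY s : I s -> theta s = Y s.
Proof.
move=> Is; case: tau_cases => [t0|tpos].
  rewrite /theta t0// mul0r mul0r; apply/esym/eqP.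
  by rewrite -normr_eq0 -tauE// t0.
pose eps (t : R) : R := (a t * v t - b t * u t) / w t ^+ 2.
have theps t : I t -> theta t = tau t * eps t.
  by move=> It; rewrite /theta /eps sqr_w// mulrA.
have eps2 t : I t -> eps t ^+ 2 = 1.
  move=> It; have [_ uv _ _] := tpos t It.
  rewrite /eps expr_div_n.
  have -> : (a t * v t - b t * u t) ^+ 2 = (w t ^+ 2) ^+ 2.
    (* Lagrange's identity, whose last square vanishes by [ab_uv]. *)
    transitivity ((a t ^+ 2 + b t ^+ 2) * (u t ^+ 2 + v t ^+ 2) -
      (a t * u t + b t * v t) ^+ 2); first by ring.
    by rewrite ab_uv// sqr_ab// uv -sqr_w//; ring.
  by rewrite divff// !expf_neq0// w_neq0.
have Y2 t : I t -> Y t ^+ 2 = tau t ^+ 2.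
  by move=> It; rewrite tauE// real_normK// num_real.
have h0 : 0 < eps s0 * Y s0.
  rewrite -theta_s0 theps// mulrCA -expr2 eps2// mulr1.
  by have [] := tpos s0 Is0.
have hneq0 t : I t -> eps t * Y t != 0.
  move=> It; rewrite -sqrf_eq0 exprMn eps2// Y2// mul1r sqrf_eq0 gt_eqF//.
  by have [] := tpos t It.
have ch t : I t -> {for t, continuous (fun t => eps t * Y t)}.
  move=> It; have [_ _ cu cv] := tpos t It.
  have ca := is_derive_continuous (da It).
  have cb := is_derive_continuous (db It).
  have cw := is_derive_continuous (is_derive_w It).
  have csg := is_derive_continuous (dsigma It).
  have ck := is_derive_continuous (derivableP (dkappa It)).
  have cbt := is_derive_continuous (derivableP (dbeta It)).
  have cal := calpha It; have cdb := cdbeta It.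
  have w0 := w_neq0 It; have k0 := kappa_neq0 It.
  rewrite /prop_for /continuous_at /eps /Y /=.
  by prove_cvg; rewrite ?mulf_neq0// ?expf_neq0.
have hpos := continuous_neq0_gt0 iI ch hneq0 Is0 h0 Is.
have hE : eps s * Y s = tau s.
  have tp : 0 < tau s by have [] := tpos s Is.
  apply/eqP; rewrite -(eqrXn2 (n := 2))// ?ltW//.
  by rewrite exprMn eps2// Y2// mul1r.
by rewrite theps// -hE mulrAC -expr2 eps2// mul1r.
Qed.

Lemma sigma_eq0 s : I s -> sigma s = 0.
Proof.
(* Putting theta = Y into [is_derive_S] leaves terms in sigma and terms in 1 - w. The latter become
   multiples of sigma by 1 - w = sigma^2 / (1 + w). [G] involves sigma and S again, but as a
   continuous function of t it makes the equation linear. *)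
pose G (t : R) : R := alpha t * kappa t ^+ 2 * sigma t / (p0 * (1 + w t))
  - kappa t * b t * S t / w t ^+ 2 - kappa t ^+ 2 - kappa t * b t * beta t / w t
  - derive1 beta t * w t * sigma t / (1 + w t) - 2 * beta t * S t.
have wp t : I t -> 1 + w t != 0.
  by move=> It; rewrite gt_eqF// addr_gt0 ?ltr01 ?w_gt0.
apply: (linear_ode2_eq0 iI (y1 := S) (G := G) dsigma _ _ Is0 sigma0 S0).
  move=> t It; apply: is_derive_eq; first exact: is_derive_S.
  rewrite theta_eqY// -derive1E /Y /G.
  have w0 := w_neq0 It; have k0 := kappa_neq0 It; have w1 := wp t It.
  have E : 1 - w t = sigma t ^+ 2 / (1 + w t).
    apply: (mulIf w1); rewrite divfK//.
    transitivity (1 - w t ^+ 2); first by ring.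
    by rewrite sqr_w//; ring.
  transitivity (G t * sigma t
      + (alpha t * kappa t ^+ 2 / p0 - derive1 beta t * w t)
        * ((1 - w t) - sigma t ^+ 2 / (1 + w t))).
    by rewrite /G; field; rewrite w0 k0 w1 p0_neq0.
  by rewrite E subrr mulr0 addr0.
move=> t It.
have cb := is_derive_continuous (db It).
have cS := is_derive_continuous (is_derive_S It).
have cw := is_derive_continuous (is_derive_w It).
have csg := is_derive_continuous (dsigma It).
have ck := is_derive_continuous (derivableP (dkappa It)).
have cbt := is_derive_continuous (derivableP (dbeta It)).
have cal := calpha It; have cdb := cdbeta It.
have w0 := w_neq0 It; have k0 := kappa_neq0 It; have w1 := wp t It.
rewrite /prop_for /continuous_at /G /=.
by prove_cvg; rewrite ?mulf_neq0// ?expf_neq0.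
Qed.

End ScalarSystem.

(** * Reduction of the theorem to the scalar system *)

Unset Implicit Arguments.
Set Strict Implicit.
Set Printing Implicit Defensive.

Theorem theorem3p3 (R : realType) (M : smooth_manifold R 3)
    (phi : M -> 'M[R]_3) (xi : M -> 'rV[R]_3) (eta : M -> 'cV[R]_3)
    (g : M -> 'M[R]_3) (alpha beta : M -> R)
    (I : set R) (gamma : R -> M)
    (r : nat) (E : nat -> R -> 'rV[R]_3) (k : nat -> R -> R)
    (p q : R -> R) :
  trans_sasakian phi xi eta g alpha beta ->
  (forall x, alpha x != 0) -> (forall x, beta x != 0) ->
  open I -> is_interval I ->
  frenet_curve g I gamma r E k ->
  let tau := torsion r k in
  let T := velocity gamma in
  let sigma := fun s => form_app eta (gamma s) (T s) in
  (forall s, I s -> sigma s ^+ 2 < 1) ->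
  (forall s, I s ->
     nabla_along g gamma T s =
       (p s / Num.sqrt (1 - sigma s ^+ 2)) *: (T s *m phi (gamma s))
       + (q s / Num.sqrt (1 - sigma s ^+ 2))
           *: (xi (gamma s) - sigma s *: T s)) ->
  (exists2 p0 : R, p0 != 0 & forall s, I s -> p s = p0) ->
  let l1 := fun s => 1 / Num.sqrt (1 - sigma s ^+ 2) in
  let l2 := fun s => - (p s * q s * sigma s
    / (Num.sqrt (1 - sigma s ^+ 2) * (p s ^+ 2 + q s ^+ 2))) in
  let l3 := fun s => - (p s ^+ 2 / (p s ^+ 2 + q s ^+ 2)
    * derive1 (fun t => beta (gamma t) / p t) s) in
  (forall s, I s ->
     tau s = `|l1 s * alpha (gamma s) + l2 s * beta (gamma s) + l3 s|) ->
  (exists s0, [/\ I s0, sigma s0 = 0, derive1 sigma s0 = 0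
     & derive1n 2 sigma s0 = 0]) ->
  almost_contact_curve eta I gamma.
Proof.
move=> ts _ _ oI iI fr tau T sigma sigma_lt1 nablaT [p0 p0_neq0 pE] l1 l2 l3.
move=> tauE [s0 [Is0 sigma0 dsigma0 ddsigma0]] s Is.
have hc := ts_acm ts; have hg := acm_metric hc.
have sg := frenet_smooth_curve fr.
have nearI t : I t -> \forall t' \near t, I t'.
  by move=> It; exact: open_nbhs_nbhs.
pose w (t : R) : R := Num.sqrt (1 - sigma t ^+ 2).
have w_gt0 t : I t -> 0 < w t.
  by move=> It; rewrite sqrtr_gt0 subr_gt0 sigma_lt1.
have w2 t : I t -> w t ^+ 2 = 1 - sigma t ^+ 2.
  by move=> It; rewrite sqr_sqrtr// subr_ge0 ltW// sigma_lt1.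
pose G t := metric_app g (gamma t).
pose phiT t := T t *m phi (gamma t).
have nearT t : I t -> \forall t' \near t, E 0%N t' = T t'.
  by move=> /nearI; apply: filterS => t'; exact: frenet_velocity fr _.
have r0 := frenet_order fr.
have nablaE0 t : I t -> nabla_along g gamma T t =
    if (1 < r)%N then k 0%N t *: E 1%N t else 0.
  move=> It; rewrite -(near_nabla_along gamma g (nearT t It)).
  by rewrite (frenet_equations fr)// add0r.
have gTT t : I t -> G t (T t) (T t) = 1.
  move=> It; rewrite /T -(frenet_velocity fr)//.
  by rewrite /G (frenet_orthonormal fr).
have gTxi t : G t (T t) (xi (gamma t)) = sigma t by rewrite /G (acm_g_xi hc).
have gphiTT t : G t (phiT t) (T t) = 0 by exact: acm_g_phi_self hc _ _.
have gphiTxi t : G t (phiT t) (xi (gamma t)) = 0.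
  by rewrite /G (acm_g_xi hc) (acm_eta_phi hc).
have gphiT2 t : I t -> G t (phiT t) (phiT t) = 1 - sigma t ^+ 2.
  by move=> It; rewrite /G (acm_compat hc) -/(G t _ _) gTT// -expr2.
have gC t x y : G t x y = G t y x by exact: metric_appC hg _ _.
(* Otherwise T would be parallel, and pairing its derivative with phi T would give p w = 0. *)
have r1 : (1 < r)%N.
  apply/negPn/negP => r1; have := nablaT s0 Is0.
  rewrite nablaE0// (negbTE r1) => /(congr1 (fun x => G s0 x (phiT s0))).
  rewrite {1}/G metric_app0l /G !(metric_appE _ hg) -/(G _ _ _).
  rewrite -!/(G _ _ _) gphiT2// (gC _ (xi _)) gphiTxi (gC _ (T _)) gphiTT.
  rewrite -/(w s0) -w2// pE// mulr0 oppr0 addr0 mulr0 addr0 => /esym/eqP.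
  by rewrite !mulf_eq0 invr_eq0 ?sqrf_eq0 (negbTE p0_neq0) gt_eqF// w_gt0.
pose N t := E 1%N t; pose kap t := k 0%N t.
(* The default 0 matches the torsion 0, so that the equation for the derivative of N takes one form
   for both kinds of frame. *)
pose B t := if (2 < r)%N then E 2%N t else 0.
pose a t := G t (N t) (phiT t); pose b t := G t (N t) (xi (gamma t)).
pose u t := G t (B t) (phiT t); pose v t := G t (B t) (xi (gamma t)).
have kap_gt0 t : I t -> 0 < kap t.
  by move=> It; exact: (frenet_curvature_pos fr).
have gNN t : I t -> G t (N t) (N t) = 1.
  by move=> It; rewrite /G (frenet_orthonormal fr).
have gTN t : I t -> G t (T t) (N t) = 0.
  by move=> It; rewrite /G /T -(frenet_velocity fr)// (frenet_orthonormal fr).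
have gTB t : I t -> G t (T t) (B t) = 0.
  move=> It; rewrite /B; case: ifPn => r2; last by rewrite gC /G metric_app0l.
  by rewrite /G /T -(frenet_velocity fr)// (frenet_orthonormal fr).
have gNB t : I t -> G t (N t) (B t) = 0.
  move=> It; rewrite /B; case: ifPn => r2; last by rewrite gC /G metric_app0l.
  by rewrite /G (frenet_orthonormal fr).
(* The given decomposition of kappa N, paired with an arbitrary x. Taking x = phi T, xi, N and B
   yields the algebraic relations of the system. *)
have gkN t x : I t -> kap t * G t (N t) x = p0 / w t * G t (phiT t) x +
    q t / w t * (G t (xi (gamma t)) x - sigma t * G t (T t) x).
  move=> It; have := nablaT t It; rewrite nablaE0// r1 pE//.
  move=> /(congr1 (fun y => G t y x)).
  rewrite /G !(metric_appDl, metric_appZl, metric_appNl) => ->.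
  by rewrite mulrDr.
have w0 t : I t -> w t != 0 by move=> It; rewrite gt_eqF// w_gt0.
have k0 t : I t -> kap t != 0 by move=> It; rewrite gt_eqF// kap_gt0.
have kapa t : I t -> kap t * a t = p0 * w t.
  move=> It; rewrite gkN// gphiT2// -w2// (gC _ (xi _)) gphiTxi.
  rewrite (gC _ (T t)) gphiTT.
  by field; exact: w0.
have kapb t : I t -> kap t * b t = q t * w t.
  move=> It; rewrite gkN// gphiTxi gTxi /G (acm_g_xi_xi hc) -expr2 -w2//.
  by field; exact: w0.
have kapE t : I t -> kap t = (p0 * a t + q t * b t) / w t.
  move=> It; have := gkN t (N t) It; rewrite gNN// mulr1 gTN// => ->.
  by rewrite (gC _ (phiT t)) (gC _ (xi _)) -/(a t) -/(b t); field; exact: w0.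
have sqr_ab t : I t -> a t ^+ 2 + b t ^+ 2 = 1 - sigma t ^+ 2.
  move=> It; apply: (mulfI (k0 t It)); rewrite -w2//.
  transitivity (kap t * a t * a t + kap t * b t * b t); first by ring.
  by rewrite kapa// kapb// [in RHS]kapE//; field; exact: w0.
have kap2 t : I t -> kap t ^+ 2 = p0 ^+ 2 + q t ^+ 2.
  move=> It; have w20 : w t ^+ 2 != 0 by rewrite expf_neq0// w0.
  apply: (mulIf w20); rewrite {1}w2// -sqr_ab//.
  transitivity ((kap t * a t) ^+ 2 + (kap t * b t) ^+ 2); first by ring.
  by rewrite kapa// kapb//; ring.
have ab_uv t : I t -> a t * u t + b t * v t = 0.
  move=> It; apply: (mulfI (k0 t It)); rewrite mulr0.
  transitivity (kap t * a t * u t + kap t * b t * v t); first by ring.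
  rewrite kapa// kapb//.
  have := gkN t (B t) It; rewrite gNB// mulr0 gTB//.
  rewrite (gC _ (phiT t)) (gC _ (xi _)) -/(u t) -/(v t).
  move=> /(congr1 ( *%R (w t ^+ 2))).
  by rewrite mulr0 => E0; apply: etrans (esym E0); field; exact: w0.
have dT t : I t -> along_derivable gamma T t.
  move=> It; apply: near_along_derivable (nearT t It) _.
  exact: smooth_along_derivable (frenet_smooth_frame fr r0) It.
have dN t : I t -> along_derivable gamma N t.
  by move=> It; exact: smooth_along_derivable (frenet_smooth_frame fr r1) It.
have dxi t : I t -> along_derivable gamma (xi \o gamma) t.
  move=> It; have h := along_derivable_field sg (acm_smooth_xi hc) It.
  exact h.
have dphiT t : I t -> along_derivable gamma phiT t.
  move=> It; by case: (nabla_along_endo sg g (acm_smooth_phi hc) It (dT t It)).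
have nablaN t : I t ->
    nabla_along g gamma N t = - kap t *: T t + tau t *: B t.
  move=> It; rewrite /N (frenet_equations fr)// /T -(frenet_velocity fr)//.
  by rewrite /tau /torsion /B; case: ifP => // _; rewrite scale0r.
have nablaTN t : I t -> nabla_along g gamma T t = kap t *: N t.
  by move=> It; rewrite nablaE0// r1.
have dsigma t : I t ->
    is_derive t 1 sigma (kap t * b t + beta (gamma t) * (1 - sigma t ^+ 2)).
  move=> It.
  rewrite (_ : sigma = fun t => G t (T t) (xi (gamma t))); last first.
    by apply/funext => t'; rewrite gTxi.
  apply: is_derive_eq.
    exact: (is_derive_metric_along sg hg It (dT t It) (dxi t It)).
  rewrite nablaTN// (nabla_xi_along ts sg It) -!/(G t _ _) -/(phiT t).
  rewrite -/(sigma t) /G !(metric_appE _ hg) -!/(G t _ _).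
  rewrite (gC _ (T t) (phiT t)) gphiTT gTT// gTxi.
  by rewrite -/(b t); ring.
have da t : I t -> is_derive t 1 a
    (tau t * u t + alpha (gamma t) * b t - beta (gamma t) * sigma t * a t).
  move=> It; apply: is_derive_eq.
    exact: (is_derive_metric_along sg hg It (dN t It) (dphiT t It)).
  rewrite nablaN// (nabla_phi_velocity ts sg It (dT t It)) nablaTN//.
  rewrite -!/(G t _ _) gTT// -/(sigma t) -/(phiT t).
  rewrite -scalemxAl /G !(metric_appE _ hg) -!/(G t _ _).
  (* The derivative of phi T contains kappa phi N, which is orthogonal to N. *)
  rewrite (gC _ (N t) (N t *m _)) (_ : G t (N t *m _) _ = 0); last first.
    exact: acm_g_phi_self hc _ _.
  rewrite (gC _ (T t) (phiT t)) gphiTT (gC _ (N t) (T t)) gTN//.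
  by rewrite -/(b t) -/(a t) -/(u t); ring.
have db t : I t -> is_derive t 1 b
    (tau t * v t - kap t * sigma t - alpha (gamma t) * a t
     - beta (gamma t) * sigma t * b t).
  move=> It; apply: is_derive_eq.
    exact: (is_derive_metric_along sg hg It (dN t It) (dxi t It)).
  rewrite nablaN// (nabla_xi_along ts sg It) -!/(G t _ _) -/(phiT t).
  rewrite -/(sigma t) /G !(metric_appE _ hg) -!/(G t _ _) gTxi.
  rewrite (gC _ (N t) (T t)) gTN//.
  by rewrite -/(b t) -/(a t) -/(v t); ring.
have dbeta t : I t -> derivable (beta \o gamma) t 1.
  move=> It; have h := derivable_function_along sg (ts_smooth_beta ts) It.
  exact h.
(* The hypothesis on the torsion after replacing q by kappa b / w and p^2 + q^2 by kappa^2. *)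
have tauE' t : I t -> tau t = `|alpha (gamma t) / w t
    - p0 * b t * sigma t * beta (gamma t) / (w t ^+ 2 * kap t)
    - p0 * derive1 (beta \o gamma) t / kap t ^+ 2|.
  move=> It; rewrite tauE// /l1 /l2 /l3 -/(w t) pE// -kap2//.
  have -> : derive1 (fun t => beta (gamma t) / p t) t =
      derive1 (beta \o gamma) t / p0.
    have nE : \forall t' \near t,
        (p0^-1 \*: (beta \o gamma)) t' = beta (gamma t') / p t'.
      by move: (nearI t It); apply: filterS => t' It'; rewrite /= pE// mulrC.
    rewrite !derive1E -(near_eq_derive _ nE) deriveZ; last exact: dbeta.
    by rewrite mulrC.
  have -> : q t = kap t * b t / w t by rewrite kapb// mulfK// w0.
  by congr (`| _ |); field; rewrite w0// k0// p0_neq0.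
have S_E t : I t -> derive1 sigma t =
    kap t * b t + beta (gamma t) * (1 - sigma t ^+ 2).
  by move=> It; rewrite derive1E; have [_ ->] := dsigma t It.
apply: (@sigma_eq0 R I oI iI sigma a b u v kap tau (alpha \o gamma)
  (beta \o gamma) p0 p0_neq0 sigma_lt1 dsigma da db _ dbeta kap_gt0 kapa
  sqr_ab ab_uv _ _ tauE' _ s0 Is0 sigma0 _ _ s Is).
- move=> t It; apply: diff_derivable.
  by have [+ _] := frenet_curvature_smooth fr r1 1%N; exact.
- move=> t It; apply/differentiable_continuous/derivable1_diffP.
  by have h := derivable_function_along sg (ts_smooth_alpha ts) It; exact h.
- move=> t It.
  have h := continuous_derive_function_along sg oI (ts_smooth_beta ts) It.
  exact h.
- case: (boolP (2 < r)%N) => r2; [right|left] => t It; last first.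
    by rewrite /tau /torsion (negbTE r2).
  have BE : B = E 2%N by apply/funext => t'; rewrite /B r2.
  have dB : along_derivable gamma B t.
    by rewrite BE; exact: smooth_along_derivable (frenet_smooth_frame fr r2) It.
  split.
  + by rewrite /tau /torsion r2; exact: (frenet_curvature_pos fr).
  (* In dimension 3 the vectors T, N, B form an orthonormal basis. Parseval for phi T gives 1 -
     sigma^2 = a^2 + u^2 and for xi gives 1 = sigma^2 + b^2 + v^2; adding them and removing a^2 +
     b^2 gives the length of (u, v). *)
  + have eo (i j : 'I_3) : G t (E i t) (E j t) = (i == j)%:R.
      rewrite /G (frenet_orthonormal fr)// ?(leq_trans _ r2)//.
    have := parseval hg (phiT t) eo; have := parseval hg (xi (gamma t)) eo.
    rewrite !big_ord_recl !big_ord0 -!/(G t _ _) /=.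
    rewrite (frenet_velocity fr)// -/(T t) -BE -/(N t).
    rewrite gphiT2// gphiTT (gC _ _ (T t)) gTxi /G (acm_g_xi_xi hc).
    rewrite -!/(G t _ _).
    rewrite !(gC _ _ (N t)) !(gC _ _ (B t)) -/(a t) -/(b t) -/(u t) -/(v t).
    by have := sqr_ab t It; lra.
  + have dBX := is_derive_metric_along sg hg It dB (dphiT t It).
    exact: (is_derive_continuous dBX).
  + have dBX := is_derive_metric_along sg hg It dB (dxi t It).
    exact: (is_derive_continuous dBX).
- by rewrite -dsigma0 S_E.
(* The formula for the derivative of sigma holds on the open set [I], which suffices to
   differentiate it at [s0]. *)
- have nE : \forall t \near s0, derive1 sigma t =
      kap t * b t + beta (gamma t) * (1 - sigma t ^+ 2).
    by move: (nearI s0 Is0); apply: filterS => t It; rewrite S_E.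
  by rewrite -(near_eq_derive _ nE) -derive1E.
Qed.
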